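(* There exists a pair of orthogonal quantum Latin squares of size 6; equivalently, there exists an AME(4,6) state in $(\mathbb{C}^6)^{\otimes4}$, and a multiunitary matrix of size 36. Consequently, orthogonal quantum Latin squares of size $N$ and AME(4,$N$) states exist for every $N\ge3$.
   Context: A pure state in $(\mathbb{C}^N)^{\otimes4}$ is AME(4,$N$) (absolutely maximally entangled) if its reduced density matrix on every pair of the four parties equals $\mathbb{I}_{N^2}/N^2$. An $N\times N$ array $\{|\psi_{ij}\rangle\}$ of vectors in $\mathbb{C}^N\otimes\mathbb{C}^N$ is a pair of orthogonal quantum Latin squares if: (1) it is an orthonormal basis of $\mathbb{C}^N\otimes\mathbb{C}^N$; (2) for each tensor factor $X$ and all $j,k$, $\mathrm{Tr}_X\sum_i|\psi_{ji}\rangle\langle\psi_{ki}|=\delta_{jk}\mathbb{I}_N$; (3) for each tensor factor $X$ and all $j,k$, $\mathrm{Tr}_X\sum_i|\psi_{ij}\rangle\langle\psi_{ik}|=\delta_{jk}\mathbb{I}_N$. For an $N^2\times N^2$ matrix $M$ indexed by pairs, $M^R_{(i,j),(k,l)}=M_{(i,k),(j,l)}$ and $M^\Gamma_{(i,j),(k,l)}=M_{(i,l),(k,j)}$; $M$ is multiunitary if $M$, $M^R$, $M^\Gamma$ are unitary. *)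

(* Defs.v *)
From HB Require Import structures.
From mathcomp Require Import all_boot all_order all_algebra.
From mathcomp Require Import complex.
From mathcomp Require Import Rstruct.
From Stdlib Require Import Rdefinitions.

Set Implicit Arguments.
Unset Strict Implicit.
Unset Printing Implicit Defensive.

Import Order.TTheory GRing.Theory Num.Theory.
Local Open Scope ring_scope.

Definition C : numClosedFieldType := (Rdefinitions.R)[i].

(* A matrix 'M[C]_(m*n) is indexed by pairs via mathcomp's [mxvec_index];
   [pair_of] is the inverse bijection. *)
Definition pair_of {m n : nat} (k : 'I_(m * n)) : 'I_m * 'I_n :=
  enum_val (cast_ord (esym (mxvec_cast m n)) k).

Definition realign {N : nat} (M : 'M[C]_(N * N)) : 'M[C]_(N * N) :=
  \matrix_(u, v) M (mxvec_index (pair_of u).1 (pair_of v).1)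
                   (mxvec_index (pair_of u).2 (pair_of v).2).

Definition ptransp {N : nat} (M : 'M[C]_(N * N)) : 'M[C]_(N * N) :=
  \matrix_(u, v) M (mxvec_index (pair_of u).1 (pair_of v).2)
                   (mxvec_index (pair_of v).1 (pair_of u).2).

Definition multiunitary {N : nat} (M : 'M[C]_(N * N)) : Prop :=
  [/\ M \is unitarymx, realign M \is unitarymx & ptransp M \is unitarymx].

(* a vector of C^N (x) C^N, given by its components psi a b
   in the product basis |a> (x) |b> *)
Definition bivec (N : nat) := 'I_N -> 'I_N -> C.

Definition dot2 {N : nat} (u v : bivec N) : C :=
  \sum_(a < N) \sum_(b < N) (u a b)^* * v a b.

Definition ptr1_outer {N : nat} (u v : bivec N) : 'M[C]_N :=
  \matrix_(b, b') \sum_(x < N) u x b * (v x b')^*.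

Definition ptr2_outer {N : nat} (u v : bivec N) : 'M[C]_N :=
  \matrix_(a, a') \sum_(y < N) u a y * (v a' y)^*.

Definition is_orthonormal_basis {N : nat} (psi : 'I_N -> 'I_N -> bivec N) : Prop :=
  (forall i j k l, dot2 (psi i j) (psi k l) = ((i == k) && (j == l))%:R) /\
  (forall v : bivec N, exists c : 'I_N -> 'I_N -> C,
      forall a b, v a b = \sum_(i < N) \sum_(j < N) c i j * psi i j a b).

Definition is_OQLS {N : nat} (psi : 'I_N -> 'I_N -> bivec N) : Prop :=
  [/\ is_orthonormal_basis psi,
      (forall j k : 'I_N,
         \sum_(i < N) ptr1_outer (psi j i) (psi k i) = ((j == k)%:R)%:M /\
         \sum_(i < N) ptr2_outer (psi j i) (psi k i) = ((j == k)%:R)%:M) &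
      (forall j k : 'I_N,
         \sum_(i < N) ptr1_outer (psi i j) (psi i k) = ((j == k)%:R)%:M /\
         \sum_(i < N) ptr2_outer (psi i j) (psi i k) = ((j == k)%:R)%:M)].

(* a vector of (C^N)^{(x)4}: components indexed by s : {ffun 'I_4 -> 'I_N} *)
Definition quadvec (N : nat) := {ffun 'I_4 -> 'I_N} -> C.

(* reduced density matrix of |Psi><Psi| on parties p, q (others traced out),
   as an N^2 x N^2 matrix indexed by pairs (value of party p, value of party q) *)
Definition rdm {N : nat} (Psi : quadvec N) (p q : 'I_4) : 'M[C]_(N * N) :=
  \matrix_(u, v)
    \sum_(s : {ffun 'I_4 -> 'I_N} | (s p == (pair_of u).1) && (s q == (pair_of u).2))
    \sum_(s' : {ffun 'I_4 -> 'I_N} | [&& s' p == (pair_of v).1, s' q == (pair_of v).2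
                                     & [forall r, ((r != p) && (r != q)) ==> (s r == s' r)]])
      Psi s * (Psi s')^*.

Definition is_AME4 {N : nat} (Psi : quadvec N) : Prop :=
  (\sum_s Psi s * (Psi s)^* = 1) /\
  (forall p q : 'I_4, p != q -> rdm Psi p q = ((N ^ 2)%:R)^-1 *: 1%:M).

(* Main.v *)
(** All three kinds of objects come from a multiunitary matrix, i.e. a four-legged
    tensor that is an isometry from any two legs to the other two.

    For N <> 6, the indicator of a pair of orthogonal Latin squares, seen as a
    transversal design with four groups, is such a tensor.  By the theorem of Bose,
    Shrikhande and Parker these designs exist for every N >= 3 other than 6: odd
    orders are linear; orders 4, 8, 10, 14 come from quasi-difference matrices;
    12 = 3 * 4, 30 = 3 * 10, 32 = 4 * 8 are products; and every other even order is
    3 t + u with t coprime to 6 and u <= t odd, so Wilson's construction applies.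

    For N = 6, take an operator diagonal in the basis of maximally entangled vectors
    (W (x) 1)|phi>, W ranging over the 36 Weyl operators, following Rather's
    construction from biunimodular vectors.  Multiunitarity then reduces to
    orthogonality relations for one 6 x 6 array, and cube roots of unity suffice as
    eigenvalues. *)

Require Import Defs.
From HB Require Import structures.
From mathcomp Require Import all_boot all_order all_algebra.
From mathcomp Require Import zify ring.

Set Implicit Arguments.
Unset Strict Implicit.
Unset Printing Implicit Defensive.

Import Order.TTheory GRing.Theory Num.Theory.
Local Open Scope ring_scope.

(* Otherwise simplification replaces the structure C by its carrier, and generic
   lemmas on big operators no longer unify. *)
Local Opaque C.

(** * Transversal designs *)

(* B is the type of blocks and D selects the blocks in use; f b p is the point where
   b meets the p-th group.  With k groups this amounts to k - 2 mutually orthogonal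
   Latin squares on S. *)
Definition transversal_design (k : nat) (S B : Type) (D : pred B)
    (f : B -> 'I_k -> S) : Prop :=
  forall p q : 'I_k, p != q -> forall x y : S,
    exists b, [/\ D b, f b p = x, f b q = y
      & forall b', D b' -> f b' p = x -> f b' q = y -> b' = b].

Definition has_td (k : nat) (S : Type) : Prop :=
  exists (B : finType) (D : pred B) (f : B -> 'I_k -> S), transversal_design D f.

(** By counting: there are as many blocks as pairs of points, so an injective map is onto. *)
Lemma td_of_injective k (S B : finType) (f : B -> 'I_k -> S) :
    #|B| = (#|S| * #|S|)%N ->
    (forall p q, p != q -> injective (fun b => (f b p, f b q))) ->
  transversal_design predT f.
Proof.
move=> cardB f_inj p q neq_pq x y.
have [|g gK fK] := inj_card_bij (f_inj p q neq_pq); first by rewrite card_prod cardB.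
have [fx fy] : f (g (x, y)) p = x /\ f (g (x, y)) q = y by have [-> ->] := fK (x, y).
exists (g (x, y)); split=> // b' _ b'x b'y.
by apply: (f_inj p q neq_pq); rewrite b'x b'y fx fy.
Qed.

Lemma has_td_equipotent k (S S' : finType) : #|S| = #|S'| -> has_td k S -> has_td k S'.
Proof.
move=> eqS [B [D [f td]]].
pose h (x : S) : S' := enum_val (cast_ord eqS (enum_rank x)).
pose h' (x : S') : S := enum_val (cast_ord (esym eqS) (enum_rank x)).
have hK : cancel h h' by move=> x; rewrite /h /h' enum_valK cast_ordK enum_rankK.
have h'K : cancel h' h by move=> x; rewrite /h /h' enum_valK cast_ordKV enum_rankK.
exists B, D, (fun b p => h (f b p)) => p q neq_pq x y.
have [b [Db bx by_ uniq_b]] := td p q neq_pq (h' x) (h' y).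
exists b; rewrite bx by_ !h'K; split=> // b' Db' b'x b'y.
by apply: uniq_b; rewrite // -[f b' _]hK ?b'x ?b'y.
Qed.

Lemma has_td_prod k (S S' : Type) : has_td k S -> has_td k S' -> has_td k (S * S').
Proof.
move=> [B [D [f td]]] [B' [D' [f' td']]].
exists (B * B')%type, (fun b => D b.1 && D' b.2), (fun b p => (f b.1 p, f' b.2 p)).
move=> p q neq_pq [x x'] [y y'].
have [b [Db bx by_ uniq_b]] := td p q neq_pq x y.
have [b' [Db' b'x b'y uniq_b']] := td' p q neq_pq x' y'.
exists (b, b'); rewrite /= Db Db' bx by_ b'x b'y; split=> // -[c c'] /= /andP[Dc Dc'].
by move=> [cx c'x] [cy c'y]; rewrite (uniq_b c) // (uniq_b' c').
Qed.

Lemma Zp_mulrn_eq0 n c (z : 'I_n.+1) : coprime c n.+1 -> z *+ c = 0 -> z = 0.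
Proof.
move=> cop; rewrite Zp_mulrn => /(congr1 val) /= /eqP.
rewrite -/(dvdn _ _) Gauss_dvdl 1?coprime_sym // => n_dvd_z.
by apply/val_inj; rewrite /= -(modn_small (ltn_ord z)); apply/eqP.
Qed.

(** Blocks are lines: group 0 records the slope [y], the others the values [x + m y] for m = 0, ...,
    k - 2. Two values fix the slope because differences of multipliers are units. *)
Lemma has_td_linear k n :
  (forall c, 0 < c < k.-1 -> coprime c n.+1)%N -> has_td k 'I_n.+1.
Proof.
move=> cop.
pose f (b : 'I_n.+1 * 'I_n.+1) (p : 'I_k) :=
  if p == 0%N :> nat then b.2 else b.1 + b.2 *+ p.-1.
exists ('I_n.+1 * 'I_n.+1)%type, predT, f.
apply: td_of_injective => [|p q]; first by rewrite card_prod !card_ord.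
wlog lt_pq : p q / (p < q)%N.
  move=> wl neq_pq [b1 b2] [c1 c2] [e1 e2].
  case: (ltngtP p q) => [lt_pq|lt_qp|/val_inj eq_pq]; last by rewrite eq_pq eqxx in neq_pq.
  - by apply: (wl p q) => //; rewrite e1 e2.
  - by apply: (wl q p); rewrite 1?eq_sym // e1 e2.
move=> _ [x y] [x' y'] []; rewrite /f /=.
have -> : q == 0%N :> nat = false by lia.
case: (posnP p) => [_ -> /addIr -> // | p_gt0].
have lt_qk := ltn_ord q.
move=> e1 e2; suff eq_y : y = y' by move: e1; rewrite eq_y => /addIr->.
apply/eqP; rewrite -subr_eq0; apply/eqP.
apply: (@Zp_mulrn_eq0 _ (q.-1 - p.-1)); first by apply: cop; lia.
rewrite mulrnBl; apply/eqP; rewrite subr_eq0; apply/eqP.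
apply: (@addrI _ (x + y *+ p.-1)); rewrite {2}e1 -!addrA -!mulrnDr subnKC //; lia.
Qed.

(** In each group, exchange [x0] with the point of a chosen block; renaming the points within a
    group preserves a design. *)
Lemma has_td_constant_block k (S : eqType) (x0 : S) : has_td k.+2 S ->
  exists (B : finType) (D : pred B) (f : B -> 'I_k.+2 -> S) (b0 : B),
    [/\ transversal_design D f, D b0 & forall p, f b0 p = x0].
Proof.
move=> [B [D [f td]]]; have [b0 [Db0 _ _ _]] := td ord0 (lift ord0 ord0) isT x0 x0.
pose h p x := if x == f b0 p then x0 else if x == x0 then f b0 p else x.
have hK p : involutive (h p).
  move=> x; rewrite /h; case: (eqVneq x (f b0 p)) => [->|neq1].
    by rewrite eqxx; case: eqP => // ->.
  by case: (eqVneq x x0) => [->|/negPf neq2]; rewrite ?eqxx // (negPf neq1) neq2.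
exists B, D, (fun b p => h p (f b p)), b0; split=> // [p q neq_pq x y|p]; last first.
  by rewrite /h eqxx.
have [b [Db bx by_ uniq_b]] := td p q neq_pq (h p x) (h q y).
exists b; rewrite bx by_ !hK; split=> // b' Db' b'x b'y.
by apply: uniq_b; rewrite // -?b'x -?b'y hK.
Qed.

(* Inflate each point of V + U by S, except in the last group, which is dropped: a
   block through a point of V there is replaced by a design on S, and a block through
   w in U by a design on option S, with w for None and without the constant block
   None.  A design on U fills the hole. *)
Lemma has_td_wilson k (V U S : finType) :
    has_td k.+3 (V + U) -> has_td k.+2 S -> has_td k.+2 (option S) -> has_td k.+2 U ->
  has_td k.+2 ((V + U) * S + U).
Proof.
move=> [B5 [D5 [f5 td5]]] [B3 [D3 [f3 td3]]] /(has_td_constant_block None).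
move=> [B4 [D4 [f4 [g0 [td4 Dg0 fg0]]]]] [BU [DU [fU tdU]]].
pose lst : 'I_k.+3 := ord_max.
pose D (b : B5 * B3 + B5 * U * B4 + BU) := match b with
  | inl (inl (e, g)) => [&& D5 e, D3 g & if f5 e lst is inl _ then true else false]
  | inl (inr (e, w, g)) => [&& D5 e, D4 g, f5 e lst == inr w & g != g0]
  | inr h => DU h
  end.
pose f (b : B5 * B3 + B5 * U * B4 + BU) (p : 'I_k.+2) : (V + U) * S + U := match b with
  | inl (inl (e, g)) => inl (f5 e (lift lst p), f3 g p)
  | inl (inr (e, w, g)) => if f4 g p is Some i then inl (f5 e (lift lst p), i) else inr w
  | inr h => inr (fU h p)
  end.
(* An inflated point and a point [w] of the hole: they lie on the block through [x] and [w],
   inflated by [option S] with [None] read as [w]. *)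
have mixed p q w x i : p != q -> exists b, [/\ D b, f b p = inl (x, i), f b q = inr w
    & forall b', D b' -> f b' p = inl (x, i) -> f b' q = inr w -> b' = b].
  move=> neq_pq; have lift_neq : lift lst p != lst by rewrite eq_sym neq_lift.
  have [e [De ex ew uniq_e]] := td5 (lift lst p) lst lift_neq x (inr w).
  have [g [Dg gi gn uniq_g]] := td4 p q neq_pq (Some i) None.
  exists (inl (inr (e, w, g))); rewrite /D /f /= De Dg ew eqxx gi gn ex; split=> //=.
    by apply/eqP=> eq_g; rewrite eq_g fg0 in gi.
  move=> [[[e' g']|[[e' w'] g']]|h] //= /and4P[De' Dg' /eqP e'w' _].
  case E: (f4 g' p) => [i'|//] [e'x i'i]; case E': (f4 g' q) => [//|] [w'w].
  rewrite w'w in e'w' *; rewrite (uniq_e e') // (uniq_g g') //.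
  by rewrite E i'i.
exists (B5 * B3 + B5 * U * B4 + BU)%type, D, f => p q neq_pq.
case=> [[x i]|w] [[y j]|w'].
- have neq_lpq : lift lst p != lift lst q by rewrite (inj_eq lift_inj).
  have [e [De ex ey uniq_e]] := td5 _ _ neq_lpq x y.
  case El: (f5 e lst) => [v|w].
    have [g [Dg gi gj uniq_g]] := td3 p q neq_pq i j.
    exists (inl (inl (e, g))); rewrite /D /f De Dg El ex ey gi gj; split=> //=.
    move=> [[[e' g']|[[e' w'] g']]|h] //=.
      by move=> /and3P[De' Dg' _] [e'x g'i] [e'y g'j]; rewrite (uniq_e e') // (uniq_g g').
    move=> /and4P[De' Dg' /eqP e'w' _].
    case E: (f4 g' p) => [i'|//] [e'x i'i]; case E': (f4 g' q) => [j'|//] [e'y j'j].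
    by rewrite (uniq_e e') // El in e'w'.
  have [g [Dg gi gj uniq_g]] := td4 p q neq_pq (Some i) (Some j).
  exists (inl (inr (e, w, g))); rewrite /D /f De Dg El eqxx ex ey gi gj; split=> //=.
    by apply/eqP=> eq_g; rewrite eq_g fg0 in gi.
  move=> [[[e' g']|[[e' w'] g']]|h] //=.
    by move=> /and3P[De' Dg' e'l] [e'x g'i] [e'y g'j]; rewrite (uniq_e e') // El in e'l.
  move=> /and4P[De' Dg' /eqP e'w' _].
  case E: (f4 g' p) => [i'|//] [e'x i'i]; case E': (f4 g' q) => [j'|//] [e'y j'j].
  rewrite (uniq_e e') // El in e'w' *; case: e'w' => <-.
  by rewrite (uniq_g g') // ?E ?E' ?i'i ?j'j.
- exact: mixed.
- have [|b [Db bx by_ uniq_b]] := mixed q p w y j; first by rewrite eq_sym.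
  by exists b; split=> // b' *; apply: uniq_b.
- have [h [Dh hw hw' uniq_h]] := tdU p q neq_pq w w'.
  exists (inr h); rewrite /D /f hw hw'; split=> //.
  move=> [[[e' g']|[[e' z] g']]|h'] //=; last first.
    by move=> Dh' [h'w] [h'w']; rewrite (uniq_h h').
  (* Two values in [U] would force [None] twice, hence the excluded constant block [g0]. *)
  move=> /and4P[_ Dg' _ neq_g0].
  case E: (f4 g' p) => [//|] _; case E': (f4 g' q) => [//|] _; case/eqP: neq_g0.
  have [g [_ _ _ uniq_g]] := td4 p q neq_pq None None.
  by rewrite (uniq_g g') // (uniq_g g0).
Qed.

(** * Designs given by explicit lists, checked by computation *)

Definition is_td_list (k n : nat) (bs : seq (seq nat)) : bool :=
  [&& size bs == n * n, all (all (fun x => x < n)) bs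
    & all (fun p => all (fun q => (p < q) ==>
        uniq [seq (nth 0 b p, nth 0 b q) | b <- bs]) (iota 0 k)) (iota 0 k)]%N.

Lemma has_td_of_list k n bs : is_td_list k n.+1 bs -> has_td k 'I_n.+1.
Proof.
case/and3P=> /eqP sz_bs /allP lt_bs /allP uniq_bs.
pose v (b : 'I_(n.+1 * n.+1)) p := nth 0%N (nth [::] bs b) p.
have v_lt b p : (v b p < n.+1)%N.
  (* Missing entries read as 0, which is below [n.+1]. *)
  have [lt_p|le_p] := ltnP p (size (nth [::] bs b)); last by rewrite /v nth_default.
  have /lt_bs/allP -> // : nth [::] bs b \in bs by rewrite mem_nth // sz_bs.
  exact: mem_nth.
pose f b (p : 'I_k) : 'I_n.+1 := Ordinal (v_lt b p).
exists 'I_(n.+1 * n.+1), predT, f.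
apply: td_of_injective => [|p q]; first by rewrite !card_ord.
wlog lt_pq : p q / (p < q)%N.
  move=> wl neq_pq b b' [e1 e2].
  have [fp fq] : f b p = f b' p /\ f b q = f b' q by split; apply: val_inj.
  case: (ltngtP p q) => [lt_pq|lt_qp|/val_inj eq_pq]; last by rewrite eq_pq eqxx in neq_pq.
  - by apply: (wl p q) => //; rewrite fp fq.
  - by apply: (wl q p); rewrite 1?eq_sym // fp fq.
move=> _ b b' [e1 e2]; apply: val_inj.
have /allP/(_ (q : nat)) : all (fun q => (p < q)%N ==>
    uniq [seq (nth 0 b p, nth 0 b q)%N | b <- bs]) (iota 0 k).
  by apply: uniq_bs; rewrite mem_iota add0n ltn_ord.
rewrite mem_iota add0n ltn_ord lt_pq => /(_ isT) /(uniqP (0, 0)%N); apply.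
- by rewrite unfold_in /= size_map sz_bs.
- by rewrite unfold_in /= size_map sz_bs.
by rewrite !(nth_map [::]) ?sz_bs ?ltn_ord // -/(v b p) -/(v b q) e1 e2.
Qed.

(* Blocks over Z_m extended by u points at infinity, numbered m, ..., m + u - 1:
   the translates of the base blocks by Z_m, which fixes infinity, together with
   the linear design on the points at infinity. *)
Definition qdm_blocks (m u : nat) (base : seq (seq nat)) : seq (seq nat) :=
  ([seq [seq if x < m then (x + c) %% m else x | x <- b] | b <- base, c <- iota 0 m]
   ++ [seq [:: m + i; m + j; m + (i + j) %% u; m + (i + j.*2) %% u]
        | i <- iota 0 u, j <- iota 0 u])%N.

(* The base blocks for orders 4 and 8 tabulate (x, y, x + y, x + g y) over GF(4)
   and GF(8), elements being written as discrete logarithms to base g, with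
   log 0 = infinity. *)
Lemma has_td4_4 : has_td 4 'I_4.
Proof.
apply: (@has_td_of_list 4 3 (qdm_blocks 3 1
  [:: [:: 0; 0; 3; 2]; [:: 0; 1; 2; 1]; [:: 0; 2; 1; 3]; [:: 0; 3; 0; 0];
      [:: 3; 0; 0; 1]]))%N.
by vm_compute.
Qed.

Lemma has_td4_8 : has_td 4 'I_8.
Proof.
apply: (@has_td_of_list 4 7 (qdm_blocks 7 1
  [:: [:: 0; 0; 7; 3]; [:: 0; 1; 3; 6]; [:: 0; 2; 6; 1]; [:: 0; 3; 1; 5];
      [:: 0; 4; 5; 4]; [:: 0; 5; 4; 2]; [:: 0; 6; 2; 7]; [:: 0; 7; 0; 0];
      [:: 7; 0; 0; 1]]))%N.
by vm_compute.
Qed.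

Definition rotations (b : seq nat) : seq (seq nat) := [seq rot i b | i <- iota 0 (size b)].

(* The base blocks for orders 10 and 14 come from a computer search among
   quasi-difference matrices invariant under cyclic shifts of the columns. *)
Lemma has_td4_10 : has_td 4 'I_10.
Proof.
apply: (@has_td_of_list 4 9 (qdm_blocks 7 3 ([:: 0; 0; 0; 0] :: flatten
  [seq rotations b | b <- [:: [:: 7; 0; 1; 6]; [:: 8; 0; 2; 5]; [:: 9; 0; 4; 3]]])))%N.
by vm_compute.
Qed.

Lemma has_td4_14 : has_td 4 'I_14.
Proof.
apply: (@has_td_of_list 4 13 (qdm_blocks 11 3 ([:: 0; 0; 0; 0] :: flatten
  [seq rotations b | b <- [:: [:: 11; 0; 3; 10]; [:: 12; 0; 4; 9]; [:: 13; 0; 1; 3];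
                              [:: 0; 6; 4; 1]]])))%N.
by vm_compute.
Qed.

(** * All orders from 3 on, except 6 *)

Lemma has_td_odd n : odd n -> has_td 4 'I_n.
Proof.
case: n => // n odd_n; apply: has_td_linear => c.
by case: c => [|[|[|c]]] // _; rewrite ?coprime1n ?coprime2n.
Qed.

Lemma has_td_mul k m n : has_td k 'I_m -> has_td k 'I_n -> has_td k 'I_(m * n).
Proof.
move=> tdm tdn; apply: has_td_equipotent (has_td_prod tdm tdn).
by rewrite card_prod !card_ord.
Qed.

(** Wilson's construction with [S] of size 3 and a hole of size [u]. The linear design with five
    groups needs 1, 2 and 3 to be units modulo [t]. *)
Lemma has_td4_3mul_add t u : coprime t 6 -> odd u -> (u <= t)%N -> has_td 4 'I_(3 * t + u).
Proof.
move=> cop odd_u le_ut.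
have [t' def_t] : exists t', t = t'.+1 by case: t cop le_ut {odd_u} => [|t'] //; exists t'.
have td5 : has_td 5 'I_t.
  rewrite def_t; apply: has_td_linear => c; rewrite -def_t.
  move: cop; rewrite (coprimeMr t 2 3) => /andP[cop2 cop3].
  by case: c => [|[|[|[|c]]]] // _; rewrite ?coprime1n // coprime_sym.
have: has_td 4 (('I_(t - u) + 'I_u) * 'I_3 + 'I_u).
  apply: has_td_wilson; last exact: has_td_odd.
  - by apply: has_td_equipotent td5; rewrite card_sum !card_ord subnK.
  - exact: has_td_odd.
  - by apply: has_td_equipotent has_td4_4; rewrite card_option !card_ord.
by apply: has_td_equipotent; rewrite card_sum card_prod card_sum !card_ord subnK // mulnC.
Qed.

Lemma has_td4 n : (3 <= n)%N -> n != 6 -> has_td 4 'I_n.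
Proof.
move=> ge3 neq6; have [|even_n] := boolP (odd n); first exact: has_td_odd.
have wilson t u : coprime t 6 -> odd u -> (u <= t)%N -> n = (3 * t + u)%N -> has_td 4 'I_n.
  by move=> ? ? ? ->; apply: has_td4_3mul_add.
have cop1 m : coprime (6 * m + 1) 6 by rewrite -coprime_modl mulnC modnMDl.
have cop5 m : coprime (6 * m + 5) 6 by rewrite -coprime_modl mulnC modnMDl.
have [lt_n36|le_36n] := ltnP n 36; last first.
  (* Write n = 18 q + r with r even. Take t = 6 q + 1, u = r - 3 if r >= 4, and t = 6 q - 1, u = r +
     3 otherwise. As q >= 2, the first case has u <= 13 <= t. *)
  have odd_r : odd (n %% 18) = false by rewrite odd_mod // (negPf even_n).
  have lt_r := ltn_pmod n (isT : 0 < 18)%N; have def_n := divn_eq n 18.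
  have [le4r|lt_r4] := leqP 4 (n %% 18).
    by apply: (wilson _ (n %% 18 - 3)%N (cop1 (n %/ 18)%N)); lia.
  by apply: (wilson _ (n %% 18 + 3)%N (cop5 (n %/ 18)%N.-1)); lia.
have: n \in [:: 4; 8; 10; 12; 14; 16; 18; 20; 22; 24; 26; 28; 30; 32; 34].
  rewrite !inE; lia.
rewrite !inE; do !case/predU1P => [eq_n|]; last move=> /eqP eq_n.
- by rewrite eq_n; apply: has_td4_4.
- by rewrite eq_n; apply: has_td4_8.
- by rewrite eq_n; apply: has_td4_10.
- by rewrite eq_n; apply: (@has_td_mul 4 3 4) has_td4_4; apply: has_td_odd.
- by rewrite eq_n; apply: has_td4_14.
- exact: (wilson 5 1).
- exact: (wilson 5 3).
- exact: (wilson 5 5).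
- exact: (wilson 7 1).
- exact: (wilson 7 3).
- exact: (wilson 7 5).
- exact: (wilson 7 7).
- by rewrite eq_n; apply: (@has_td_mul 4 3 10) has_td4_10; apply: has_td_odd.
- by rewrite eq_n; apply: (@has_td_mul 4 4 8) has_td4_8; apply: has_td4_4.
- exact: (wilson 11 1).
Qed.

(** * Perfect tensors *)

Lemma pair_ofK m n (i : 'I_m) (j : 'I_n) : pair_of (mxvec_index i j) = (i, j).
Proof. by rewrite /pair_of /mxvec_index cast_ordK enum_rankK. Qed.

Lemma mxvec_index_eq m n (i i' : 'I_m) (j j' : 'I_n) :
  (mxvec_index i j == mxvec_index i' j') = (i == i') && (j == j').
Proof.
apply/eqP/andP => [eq_ij|[/eqP-> /eqP->] //].
by have := congr1 pair_of eq_ij; rewrite !pair_ofK => -[-> ->].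
Qed.

Lemma sum_mxvec_index (R : nmodType) m n (F : 'I_(m * n) -> R) :
  \sum_u F u = \sum_i \sum_j F (mxvec_index i j).
Proof. by rewrite (reindex _ (curry_mxvec_bij _ _)) /= pair_bigA; apply: eq_bigr => -[]. Qed.

Lemma unitarymx_pairP N (M : 'M[C]_(N * N)) :
  M \is unitarymx <->
  forall a b a' b', \sum_c \sum_d M (mxvec_index a b) (mxvec_index c d)
    * (M (mxvec_index a' b') (mxvec_index c d))^* = ((a == a') && (b == b'))%:R.
Proof.
split=> [/unitarymxP MM1 a b a' b'|MM1].
  move/matrixP/(_ (mxvec_index a b) (mxvec_index a' b')): MM1.
  rewrite !mxE mxvec_index_eq sum_mxvec_index => <-.
  by apply: eq_bigr => c _; apply: eq_bigr => d _; rewrite !mxE.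
apply/unitarymxP/matrixP => u v.
case/mxvec_indexP: u => a b; case/mxvec_indexP: v => a' b'.
rewrite !mxE mxvec_index_eq sum_mxvec_index -MM1.
by apply: eq_bigr => c _; apply: eq_bigr => d _; rewrite !mxE.
Qed.

Lemma unitarymx_pair_trP N (M : 'M[C]_(N * N)) : M \is unitarymx ->
  forall c d c' d', \sum_a \sum_b M (mxvec_index a b) (mxvec_index c d)
    * (M (mxvec_index a b) (mxvec_index c' d'))^* = ((c == c') && (d == d'))%:R.
Proof.
rewrite -trmx_unitary => /unitarymx_pairP MM1 c d c' d'.
by rewrite -MM1; apply: eq_bigr => a _; apply: eq_bigr => b _; rewrite !mxE.
Qed.

Lemma realignE N (M : 'M[C]_(N * N)) a b c d :
  realign M (mxvec_index a b) (mxvec_index c d) = M (mxvec_index a c) (mxvec_index b d).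
Proof. by rewrite mxE !pair_ofK. Qed.

Lemma ptranspE N (M : 'M[C]_(N * N)) a b c d :
  ptransp M (mxvec_index a b) (mxvec_index c d) = M (mxvec_index a d) (mxvec_index c b).
Proof. by rewrite mxE !pair_ofK. Qed.

(* The six equations say that a tensor T is an isometry from any two of its
   legs to the other two. *)
Definition perfect_tensor N (T : 'I_N -> 'I_N -> 'I_N -> 'I_N -> C) : Prop :=
  forall a b a' b', let delta := ((a == a') && (b == b'))%:R in
  [/\ \sum_c \sum_d T a b c d * (T a' b' c d)^* = delta,
      \sum_c \sum_d T a c b d * (T a' c b' d)^* = delta &
      \sum_c \sum_d T a c d b * (T a' c d b')^* = delta] /\
  [/\ \sum_c \sum_d T c d a b * (T c d a' b')^* = delta,
      \sum_c \sum_d T c a d b * (T c a' d b')^* = delta &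
      \sum_c \sum_d T c a b d * (T c a' b' d)^* = delta].

(** The rows of [M], [realign M] and [ptransp M] give the first three equations, their columns the
    last three. *)
Lemma perfect_tensor_of_multiunitary N (M : 'M[C]_(N * N)) : multiunitary M ->
  perfect_tensor (fun a b c d => M (mxvec_index a b) (mxvec_index c d)).
Proof.
case=> uM uR uG.
have tM := unitarymx_pair_trP uM.
have tR := unitarymx_pair_trP uR; have tG := unitarymx_pair_trP uG.
move/unitarymx_pairP: uM => uM.
move/unitarymx_pairP: uR => uR; move/unitarymx_pairP: uG => uG.
move=> a b a' b'; split; split=> //.
- by rewrite -uR; apply: eq_bigr => c _; apply: eq_bigr => d _; rewrite !realignE.
- rewrite -uG exchange_big; apply: eq_bigr => c _; apply: eq_bigr => d _.
  by rewrite !ptranspE.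
- by rewrite -tR; apply: eq_bigr => c _; apply: eq_bigr => d _; rewrite !realignE.
- by rewrite andbC -tG; apply: eq_bigr => c _; apply: eq_bigr => d _; rewrite !ptranspE.
Qed.

(** A square matrix with orthonormal rows is unitary, so the three equations that fix the first leg
    suffice. *)
Lemma multiunitary_of_tensor N (T : 'I_N -> 'I_N -> 'I_N -> 'I_N -> C) :
    (forall a b a' b', let delta := ((a == a') && (b == b'))%:R in
      [/\ \sum_c \sum_d T a b c d * (T a' b' c d)^* = delta,
          \sum_c \sum_d T a c b d * (T a' c b' d)^* = delta &
          \sum_c \sum_d T a c d b * (T a' c d b')^* = delta]) ->
  exists M : 'M[C]_(N * N), multiunitary M.
Proof.
move=> TT; pose M : 'M[C]_(N * N) :=
  \matrix_(u, v) T (pair_of u).1 (pair_of u).2 (pair_of v).1 (pair_of v).2.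
have ME a b c d : M (mxvec_index a b) (mxvec_index c d) = T a b c d.
  by rewrite mxE !pair_ofK.
exists M; split; apply/unitarymx_pairP => a b a' b'; have [T1 T2 T3] := TT a b a' b'.
- by rewrite -T1; apply: eq_bigr => c _; apply: eq_bigr => d _; rewrite !ME.
- by rewrite -T2; apply: eq_bigr => c _; apply: eq_bigr => d _; rewrite !realignE !ME.
- rewrite -T3 exchange_big; apply: eq_bigr => c _; apply: eq_bigr => d _.
  by rewrite !ptranspE !ME.
Qed.

(** Legs 1 and 2 label the vectors, legs 3 and 4 are their tensor factors; each partial trace
    condition fixes one label and one factor. *)
Lemma OQLS_of_multiunitary N (M : 'M[C]_(N * N)) : multiunitary M ->
  is_OQLS (fun i j a b => M (mxvec_index i j) (mxvec_index a b)).
Proof.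
move=> multiM; have TT := perfect_tensor_of_multiunitary multiM.
have natr_andb (x y : bool) : x%:R *+ y = (x && y)%:R :> C by case: x; case: y.
split; first split=> [i j k l|v].
(* [dot2] conjugates its first argument, the tensor equations their second; hence the exchanged
   pairs. *)
- rewrite [i == k]eq_sym [j == l]eq_sym; have [[<- _ _] _] := TT k l i j.
  by apply: eq_bigr => a _; apply: eq_bigr => b _; apply: mulrC.
- have [/unitarymx_unit unitM _ _] := multiM.
  pose w := \row_u v (pair_of u).1 (pair_of u).2; pose c := w *m invmx M.
  exists (fun i j => c 0 (mxvec_index i j)) => a b.
  have -> : v a b = w 0 (mxvec_index a b) by rewrite mxE pair_ofK.
  by rewrite -(mulmxKV unitM w) -/c mxE sum_mxvec_index.
- move=> j k; split; apply/matrixP => b b'; rewrite summxE !mxE natr_andb.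
    have [[_ _ <-] _] := TT j b k b'; apply: eq_bigr => i _; rewrite mxE.
    by apply: eq_bigr.
  have [[_ <- _] _] := TT j b k b'; apply: eq_bigr => i _; rewrite mxE.
  by apply: eq_bigr.
- move=> j k; split; apply/matrixP => b b'; rewrite summxE !mxE natr_andb.
    have [_ [_ <- _]] := TT j b k b'; apply: eq_bigr => i _; rewrite mxE.
    by apply: eq_bigr.
  have [_ [_ _ <-]] := TT j b k b'; apply: eq_bigr => i _; rewrite mxE.
  by apply: eq_bigr.
Qed.

(** * Reduced density matrices of four parties *)

Definition quad N (p q r : 'I_4) (a b c d : 'I_N) : {ffun 'I_4 -> 'I_N} :=
  [ffun i => if i == p then a else if i == q then b else if i == r then c else d].

Lemma quad_swap N (p q r : 'I_4) (a b c d : 'I_N) : p != q ->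
  quad q p r a b c d = quad p q r b a c d.
Proof.
move=> /negPf neq_pq; apply/ffunP=> i; rewrite !ffunE.
by case: (eqVneq i p) => [->|]; rewrite ?neq_pq.
Qed.

Lemma sum_quad (R : nmodType) N (F : {ffun 'I_4 -> 'I_N} -> R) (p q r t : 'I_4) (a b : 'I_N) :
    uniq [:: p; q; r; t] ->
  \sum_(s : {ffun 'I_4 -> 'I_N} | (s p == a) && (s q == b)) F s
    = \sum_c \sum_d F (quad p q r a b c d).
Proof.
move=> /= /and4P[]; rewrite !inE !negb_or => /and3P[pq pr pt] /andP[qr qt] rt _.
rewrite pair_bigA /=.
rewrite (reindex_onto (fun x => quad p q r a b x.1 x.2)
                      (fun s : {ffun _ -> _} => (s r, s t))) /=; last first.
  move=> s /andP[/eqP sp /eqP sq]; apply/ffunP=> i; rewrite ffunE.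
  case: eqP => [->//|/eqP ip]; case: eqP => [->//|/eqP iq]; case: eqP => [->//|/eqP ir].
  (* Four distinct indices exhaust ['I_4], so [i] is [t]. *)
  congr (s _); apply: val_inj => /=; move: pq pr pt qr qt rt ip iq ir; rewrite -!val_eqE /=.
  have ltp := ltn_ord p; have ltq := ltn_ord q; have ltr := ltn_ord r; have ltt := ltn_ord t.
  have := ltn_ord i; lia.
apply: eq_bigl => -[c d]; rewrite !ffunE /= !eqxx.
rewrite ![r == _]eq_sym ![t == _]eq_sym (negPf pr) (negPf qr) (negPf pt) (negPf qt).
by rewrite [q == p]eq_sym (negPf pq) !eqxx (negPf rt) eqxx.
Qed.

Lemma rdm_quad N (Psi : quadvec N) (p q r t : 'I_4) a b a' b' : uniq [:: p; q; r; t] ->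
  rdm Psi p q (mxvec_index a b) (mxvec_index a' b') =
  \sum_c \sum_d Psi (quad p q r a b c d) * (Psi (quad p q r a' b' c d))^*.
Proof.
move=> uniq4; rewrite mxE !pair_ofK /= (sum_quad _ _ _ uniq4).
apply: eq_bigr => c _; apply: eq_bigr => d _.
rewrite (big_pred1 (quad p q r a' b' c d)) // => s /=.
move: uniq4 => /= /and4P[]; rewrite !inE !negb_or => /and3P[pq pr pt] /andP[qr qt] rt _.
apply/and3P/eqP => [[/eqP sp /eqP sq /forallP srt]|->]; last first.
  split; first by rewrite ffunE eqxx.
    by rewrite ffunE eqxx [q == p]eq_sym (negPf pq).
  by apply/forallP=> i; apply/implyP=> /andP[/negPf ip /negPf iq]; rewrite !ffunE ip iq.
apply/ffunP=> i; rewrite ffunE.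
case: eqP => [->//|/eqP ip]; case: eqP => [->//|/eqP iq].
by have := srt i; rewrite ip iq => /eqP <-; rewrite !ffunE (negPf ip) (negPf iq).
Qed.

(** The state has the entries of [M] divided by N as components. Each tensor equation, divided by
    N^2, is the reduced density matrix on one pair of parties. *)
Lemma AME4_of_multiunitary N (M : 'M[C]_(N * N)) : (0 < N)%N -> multiunitary M ->
  exists Psi : quadvec N, is_AME4 Psi.
Proof.
move=> N_gt0 /perfect_tensor_of_multiunitary.
set T := (T in perfect_tensor T) => TT.
pose i0 : 'I_4 := Ordinal (isT : 0 < 4)%N; pose i1 : 'I_4 := Ordinal (isT : 1 < 4)%N.
pose i2 : 'I_4 := Ordinal (isT : 2 < 4)%N; pose i3 : 'I_4 := Ordinal (isT : 3 < 4)%N.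
pose Psi : quadvec N := fun s => N%:R^-1 * T (s i0) (s i1) (s i2) (s i3).
have N2 : (N ^ 2)%:R^-1 = N%:R^-1 * (N%:R^-1)^* :> C.
  by rewrite fmorphV rmorph_nat natrX -exprVn expr2.
have sumE p q r t (T' : 'I_N -> 'I_N -> 'I_N -> 'I_N -> C) a b a' b' :
    uniq [:: p; q; r; t] ->
    (forall a b c d, Psi (quad p q r a b c d) = N%:R^-1 * T' a b c d) ->
    \sum_c \sum_d T' a b c d * (T' a' b' c d)^* = ((a == a') && (b == b'))%:R ->
  \sum_c \sum_d Psi (quad p q r a b c d) * (Psi (quad p q r a' b' c d))^*
    = (N ^ 2)%:R^-1 * ((a == a') && (b == b'))%:R.
  move=> uniq4 PsiE <-; rewrite mulr_sumr.
  apply: eq_bigr => c _; rewrite mulr_sumr; apply: eq_bigr => d _.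
  by rewrite !PsiE rmorphM N2 mulrACA.
have rdmE p q r t (T' : 'I_N -> 'I_N -> 'I_N -> 'I_N -> C) : uniq [:: p; q; r; t] ->
    (forall a b c d, Psi (quad p q r a b c d) = N%:R^-1 * T' a b c d) ->
    (forall a b a' b', \sum_c \sum_d T' a b c d * (T' a' b' c d)^*
       = ((a == a') && (b == b'))%:R) ->
  rdm Psi p q = (N ^ 2)%:R^-1 *: 1%:M.
  move=> uniq4 PsiE TT'; apply/matrixP => u v.
  case/mxvec_indexP: u => a b; case/mxvec_indexP: v => a' b'.
  by rewrite (@rdm_quad _ _ _ _ r t) // !mxE mxvec_index_eq (sumE _ _ _ t T').
exists Psi; split.
  (* Grouped by the values of the first two parties, the norm is a sum of N^2 terms equal to 1 /
     N^2. *)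
  rewrite (partition_big (fun s : {ffun 'I_4 -> 'I_N} => (s i0, s i1)) predT) //=.
  rewrite (eq_bigr (fun=> (N ^ 2)%:R^-1)) => [|[a b] _].
    rewrite sumr_const card_prod !card_ord -mulnn -[LHS]mulr_natr mulVf //.
    by rewrite pnatr_eq0 -lt0n muln_gt0 N_gt0.
  rewrite (eq_bigl _ _ (fun s : {ffun 'I_4 -> 'I_N} => xpair_eqE (s i0) a (s i1) b)).
  rewrite (@sum_quad _ _ _ i0 i1 i2 i3) // (sumE i0 i1 i2 i3 T) ?eqxx ?mulr1 //.
    by move=> *; rewrite /Psi !ffunE.
  by have [[-> _ _] _] := TT a b a b; rewrite !eqxx.
have I4 (p : 'I_4) : [\/ p = i0, p = i1, p = i2 | p = i3].
  case: p => [[|[|[|[|p]]]] ltp] //;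
    [constructor 1 | constructor 2 | constructor 3 | constructor 4]; exact: val_inj.
have rdm_lt (p q : 'I_4) : (p < q)%N ->
    rdm Psi p q = (N ^ 2)%:R^-1 *: 1%:M /\ rdm Psi q p = (N ^ 2)%:R^-1 *: 1%:M.
  have both r t (T' : 'I_N -> 'I_N -> 'I_N -> 'I_N -> C) : uniq [:: p; q; r; t] ->
      (forall a b c d, Psi (quad p q r a b c d) = N%:R^-1 * T' a b c d) ->
      (forall a b a' b', \sum_c \sum_d T' a b c d * (T' a' b' c d)^*
         = ((a == a') && (b == b'))%:R) ->
    rdm Psi p q = (N ^ 2)%:R^-1 *: 1%:M /\ rdm Psi q p = (N ^ 2)%:R^-1 *: 1%:M.
    move=> uniq4 PsiE TT'; split; first exact: (rdmE _ _ r t T').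
    apply: (rdmE _ _ r t (fun a b => T' b a)) => [|a b c d|a b a' b'].
    - by rewrite (perm_uniq (permEl (perm_catCA [:: q] [:: p] [:: r; t]))).
    - by rewrite quad_swap //; case/andP: uniq4; rewrite !inE !negb_or => /andP[].
    - by rewrite andbC TT'.
  case: (I4 p) both => ->; case: (I4 q) => -> both // _.
  - apply: (both i2 i3 T) => // [*|a b a' b']; first by rewrite /Psi !ffunE.
    by have [[]] := TT a b a' b'.
  - apply: (both i1 i3 (fun a b c d => T a c b d)) => // [*|a b a' b'].
      by rewrite /Psi !ffunE.
    by have [[]] := TT a b a' b'.
  - apply: (both i1 i2 (fun a b c d => T a c d b)) => // [*|a b a' b'].
      by rewrite /Psi !ffunE.
    by have [[]] := TT a b a' b'.
  - apply: (both i0 i3 (fun a b c d => T c a b d)) => // [*|a b a' b'].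
      by rewrite /Psi !ffunE.
    by have [_ []] := TT a b a' b'.
  - apply: (both i0 i2 (fun a b c d => T c a d b)) => // [*|a b a' b'].
      by rewrite /Psi !ffunE.
    by have [_ []] := TT a b a' b'.
  - apply: (both i0 i1 (fun a b c d => T c d a b)) => // [*|a b a' b'].
      by rewrite /Psi !ffunE.
    by have [_ []] := TT a b a' b'.
(* The statement's N ^ 2 elaborates to the power function of Stdlib. *)
have powE : PeanoNat.Nat.pow N 2 = (N ^ 2)%N by rewrite -mulnn /=; lia.
by move=> p q; rewrite powE -val_eqE neq_ltn => /orP[/rdm_lt[]|/rdm_lt[]].
Qed.

(** In each sum only the block through [a], [b] contributes, at one pair [c], [d]. The block through
    [c], [d] is unique as well, so [a'], [b'] must be [a], [b]. *)
Lemma multiunitary_of_td N : has_td 4 'I_N -> exists M : 'M[C]_(N * N), multiunitary M.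
Proof.
move=> [B [D [f td]]].
pose P p q r t a b c d :=
  [exists e, [&& D e, f e p == a, f e q == b, f e r == c & f e t == d]].
have sumP p q r t a b a' b' : p != q -> r != t ->
    \sum_c \sum_d (P p q r t a b c d)%:R * ((P p q r t a' b' c d)%:R)^*
      = ((a == a') && (b == b'))%:R :> C.
  move=> neq_pq neq_rt; have [e [De ea eb uniq_e]] := td p q neq_pq a b.
  have PE c d : P p q r t a b c d = (c == f e r) && (d == f e t).
    apply/existsP/andP => [[e' /and5P[De' /eqP e'a /eqP e'b]]|[/eqP-> /eqP->]].
      by rewrite (uniq_e e') // eq_sym => -> ; rewrite eq_sym.
    by exists e; rewrite De ea eb !eqxx.
  rewrite (bigD1 (f e r)) //= [X in _ + X]big1 => [|c /negPf neq_c]; last first.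
    by apply: big1 => d _; rewrite PE neq_c mul0r.
  rewrite (bigD1 (f e t)) //= big1 => [|d /negPf neq_d]; last first.
    by rewrite PE neq_d andbF mul0r.
  rewrite PE !eqxx mul1r rmorph_nat !addr0; congr (_%:R); congr nat_of_bool.
  apply/existsP/andP => [[e' /and5P[De' /eqP e'a /eqP e'b /eqP e'r /eqP e't]]|]; last first.
    by case=> /eqP <- /eqP <-; exists e; rewrite De ea eb !eqxx.
  have [g [_ _ _ uniq_g]] := td r t neq_rt (f e r) (f e t).
  by rewrite -ea -eb -e'a -e'b (uniq_g e) // (uniq_g e') ?eqxx.
pose i0 : 'I_4 := Ordinal (isT : 0 < 4)%N; pose i1 : 'I_4 := Ordinal (isT : 1 < 4)%N.
pose i2 : 'I_4 := Ordinal (isT : 2 < 4)%N; pose i3 : 'I_4 := Ordinal (isT : 3 < 4)%N.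
apply: (@multiunitary_of_tensor _ (fun a b c d => (P i0 i1 i2 i3 a b c d)%:R)).
have P2 a b c d : P i0 i1 i2 i3 a c b d = P i0 i2 i1 i3 a b c d.
  by apply: eq_existsb => e; rewrite [(f e i1 == c) && _]andbCA.
have P3 a b c d : P i0 i1 i2 i3 a c d b = P i0 i3 i1 i2 a b c d.
  by apply: eq_existsb => e; rewrite andbA [in RHS]andbA; congr (_ && _); rewrite andbA andbC.
move=> a b a' b' /=; split; first exact: sumP.
- rewrite -(sumP i0 i2 i1 i3 a b a' b') //.
  by apply: eq_bigr => c _; apply: eq_bigr => d _; rewrite !P2.
- rewrite -(sumP i0 i3 i1 i2 a b a' b') //.
  by apply: eq_bigr => c _; apply: eq_bigr => d _; rewrite !P3.
Qed.

(** * Order six *)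

Lemma sum_if_eq (R : nmodType) (I : finType) (i : I) (F : I -> R) :
  \sum_j (if j == i then F j else 0) = F i.
Proof. by rewrite -big_mkcond big_pred1_eq. Qed.

(* The tensor of an operator diagonal in the Bell basis of Weyl operators:
   [L x] is the Fourier transform of its eigenvalues on the operators with shift x. *)
Lemma multiunitary_of_bell_diagonal n (L : 'I_n.+2 -> 'I_n.+2 -> C) :
    (forall x b b', \sum_d L x (b - d) * (L x (b' - d))^* = (b == b')%:R) ->
    (forall y a a', \sum_c L (a - c) y * (L (a' - c) y)^* = (a == a')%:R) ->
    (forall s a a', \sum_c L (a - c) (a + c - s) * (L (a' - c) (a' + c - s))^*
       = (a == a')%:R) ->
  exists M : 'M[C]_(n.+2 * n.+2), multiunitary M.
Proof.
move=> rowL colL twistL.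
apply: (@multiunitary_of_tensor _
  (fun a b c d => if a + d == b + c then L (a - b) (b - d) else 0)).
have sum_cond (I : finType) (i : I) (Q : pred I) (F G : I -> C) : Q =1 pred1 i ->
    \sum_j (if Q j then F j else 0) * G j = F i * G i.
  move=> QE; rewrite -(sum_if_eq i (fun j => F j * G j)); apply: eq_bigr => j _.
  by rewrite QE /=; case: eqP => // _; rewrite mul0r.
move=> a b a' b'; split.
(* The support condition leaves only c = a + d - b, and both factors survive only if a' - b' = a -
   b; then [rowL] applies at x = a - b. *)
- rewrite exchange_big /=.
  transitivity (\sum_d L (a - b) (b - d) *
      (if a' - b' == a - b then L (a - b) (b' - d) else 0)^*).
    apply: eq_bigr => d _; rewrite (sum_cond _ (a + d - b)) => [|c]; last first.
      by apply/eqP/eqP => [e|->]; [rewrite e|]; ring.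
    congr (_ * _^*); rewrite -subr_eq0 -[in RHS]subr_eq0.
    have -> : a' + d - (b' + (a + d - b)) = a' - b' - (a - b) by ring.
    by rewrite subr_eq0; case: eqP => // ->.
  case: eqP => [eq_x|neq_x]; last first.
    rewrite big1 => [|d _]; last by rewrite rmorph0 mulr0.
    by case: andP => // -[/eqP eq_a /eqP eq_b]; case: neq_x; rewrite eq_a eq_b.
  rewrite rowL; congr (_%:R); congr nat_of_bool.
  case: (eqVneq b b') => [eq_b|]; last by rewrite andbF.
  by rewrite andbT; apply/esym/eqP; apply: (@addIr _ (- b)); rewrite {2}eq_b.
- transitivity (\sum_c L (a - c) (a - b) *
      (if a' - b' == a - b then L (a' - c) (a - b) else 0)^*).
    apply: eq_bigr => c _; rewrite (sum_cond _ (c + b - a)) => [|d]; last first.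
      by apply/eqP/eqP => [e|->]; [rewrite -e|]; ring.
    have -> : c - (c + b - a) = a - b by ring.
    congr (_ * _^*); rewrite -subr_eq0 -[in RHS]subr_eq0.
    have -> : a' + (c + b - a) - (c + b') = a' - b' - (a - b) by ring.
    by rewrite subr_eq0; case: eqP => // ->.
  case: eqP => [eq_x|neq_x]; last first.
    rewrite big1 => [|d _]; last by rewrite rmorph0 mulr0.
    by case: andP => // -[/eqP eq_a /eqP eq_b]; case: neq_x; rewrite eq_a eq_b.
  rewrite colL; congr (_%:R); congr nat_of_bool; case: (eqVneq a a') => // eq_a.
  by apply/esym/eqP/oppr_inj/(@addrI _ a); rewrite {2}eq_a eq_x.
(* Here the shared quantity is a + b, which becomes [s] in [twistL]. *)
- transitivity (\sum_c L (a - c) (a + c - (a + b)) *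
      (if a' + b' == a + b then L (a' - c) (a' + c - (a + b)) else 0)^*).
    apply: eq_bigr => c _; rewrite (sum_cond _ (a + b - c)) => [|d]; last first.
      by apply/eqP/eqP => [e|->]; [rewrite e|]; ring.
    have -> : c - b = a + c - (a + b) by ring.
    congr (_ * _^*); rewrite -subr_eq0 -[in RHS]subr_eq0.
    have -> : a' + b' - (c + (a + b - c)) = a' + b' - (a + b) by ring.
    rewrite subr_eq0; case: eqP => // <-; congr (L _ _); ring.
  case: eqP => [eq_x|neq_x]; last first.
    rewrite big1 => [|d _]; last by rewrite rmorph0 mulr0.
    by case: andP => // -[/eqP eq_a /eqP eq_b]; case: neq_x; rewrite eq_a eq_b.
  rewrite twistL; congr (_%:R); congr nat_of_bool; case: (eqVneq a a') => // eq_a.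
  by apply/esym/eqP/(@addrI _ a); rewrite {2}eq_a eq_x.
Qed.

(** * Exact arithmetic with cube roots of unity *)

Lemma cubic_root_of_unity (F : numClosedFieldType) :
  exists w : F, w ^+ 2 = - 1 - w /\ w^* = - 1 - w.
Proof.
pose s : F := 'i * sqrtC 3%:R.
have s2 : s ^+ 2 = - 3%:R by rewrite exprMn sqrCi sqrtCK mulN1r.
have sJ : s^* = - s.
  by rewrite rmorphM /= conjCi geC0_conj ?sqrtC_ge0 ?ler0n // mulNr.
have two0 : 2%:R != 0 :> F by rewrite pnatr_eq0.
exists ((s - 1) / 2%:R); split; last first.
  by rewrite rmorphM fmorphV rmorphB rmorph1 rmorph_nat /= sJ; field.
have -> : ((s - 1) / 2%:R) ^+ 2 = (s ^+ 2 - 2%:R * s + 1) / 4%:R by field.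
by rewrite s2; field.
Qed.

(* The pair (x, y) stands for x + y w, where w is a primitive cube root of unity. *)
Definition eisenstein := (int * int)%type.
Definition eis_add (x y : eisenstein) : eisenstein := (x.1 + y.1, x.2 + y.2).
Definition eis_mul (x y : eisenstein) : eisenstein :=
  (x.1 * y.1 - x.2 * y.2, x.1 * y.2 + x.2 * y.1 - x.2 * y.2).
Definition eis_conj (x : eisenstein) : eisenstein := (x.1 - x.2, - x.2).
Definition eis_val (F : pzRingType) (w : F) (x : eisenstein) : F := x.1%:~R + x.2%:~R * w.

(* Six times the array L of [multiunitary_of_bell_diagonal]: entry (x, y) is
   sum_z w^K(x,z) zeta^(y z) with zeta = 1 + w, a primitive sixth root of
   unity, for the following exponents K, found by simulated annealing:
     2 1 2 0 2 2 / 0 2 0 2 2 2 / 1 1 2 1 0 1 / 0 1 0 2 2 0 / 0 1 2 2 1 0 / 2 0 2 2 1 1 *)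
Definition bell6_table : seq (seq eisenstein) :=
  [:: [:: (-3, -3); (-3, 0); (0, 0); (-3, -3); (3, 0); (0, 0)];
      [:: (-2, -4); (1, 2); (1, -1); (4, 2); (1, 2); (1, -1)];
      [:: (0, 3); (0, 0); (0, 3); (0, -3); (0, 0); (0, 3)];
      [:: (1, -1); (1, 2); (-2, -4); (1, -1); (1, 2); (4, 2)];
      [:: (0, 0); (3, 0); (-3, -3); (0, 0); (3, 0); (3, 3)];
      [:: (-2, -1); (4, 2); (-2, -1); (-2, -1); (-2, -4); (-2, -1)]]%Z.

Definition bell6 (x y : nat) : eisenstein := nth (0, 0) (nth [::] bell6_table x) y.

(** The negative is reduced first, as in ['I_6], so that ring operations there convert to this. *)
Definition sub6 (x y : nat) : nat := (x + (6 - y) %% 6) %% 6.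
Definition add6 (x y : nat) : nat := (x + y) %% 6.

Definition eis_dot6 (u v : nat -> eisenstein) : eisenstein :=
  foldr eis_add (0, 0) [seq eis_mul (u i) (eis_conj (v i)) | i <- iota 0 6].

Definition for6 (P : nat -> nat -> nat -> bool) : bool :=
  all (fun x => all (fun y => all (P x y) (iota 0 6)) (iota 0 6)) (iota 0 6).

(** These are the hypotheses of [multiunitary_of_bell_diagonal], scaled by 36 because the table
    holds six times [L]. *)
Lemma bell6_check : for6 (fun s a b => let delta := ((if a == b then 36 else 0)%Z, 0) in
  [&& eis_dot6 (fun i => bell6 s (sub6 a i)) (fun i => bell6 s (sub6 b i)) == delta,
      eis_dot6 (fun i => bell6 (sub6 a i) s) (fun i => bell6 (sub6 b i) s) == delta &
      eis_dot6 (fun i => bell6 (sub6 a i) (sub6 (add6 a i) s))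
               (fun i => bell6 (sub6 b i) (sub6 (add6 b i) s)) == delta]).
Proof. by vm_compute. Qed.

Lemma for6P P : for6 P -> forall x y z : 'I_6, P x y z.
Proof.
have in6 (x : 'I_6) : (x : nat) \in iota 0 6 by rewrite mem_iota ltn_ord.
by move=> /allP allP6 x y z; have /allP/(_ _ (in6 y))/allP := allP6 _ (in6 x); apply.
Qed.

(** The two relations make [eis_val w] respect sums, products and conjugation. *)
Lemma eis_dot6E (F : numClosedFieldType) (w : F) (u v : nat -> eisenstein) :
    w ^+ 2 = - 1 - w -> w^* = - 1 - w ->
  \sum_(i < 6) eis_val w (u i) * (eis_val w (v i))^* = eis_val w (eis_dot6 u v).
Proof.
move=> w2 wJ.
have valD x y : eis_val w (eis_add x y) = eis_val w x + eis_val w y.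
  by rewrite /eis_val /= !rmorphD; ring.
have valM x y : eis_val w (eis_mul x y) = eis_val w x * eis_val w y.
  have -> : eis_val w x * eis_val w y = x.1%:~R * y.1%:~R
    + (x.1%:~R * y.2%:~R + x.2%:~R * y.1%:~R) * w + x.2%:~R * y.2%:~R * w ^+ 2.
    by rewrite /eis_val; ring.
  by rewrite w2 /eis_val /= !(rmorphB, rmorphD, rmorphM); ring.
have valJ x : eis_val w (eis_conj x) = (eis_val w x)^*.
  rewrite /eis_val /= [RHS]rmorphD [X in _ = _ + X]rmorphM !rmorph_int /= wJ.
  by rewrite rmorphB rmorphN; ring.
rewrite -(big_mkord predT (fun i => eis_val w (u i) * (eis_val w (v i))^*)).
rewrite /eis_dot6 /index_iota; elim: (iota _ _) => [|i r IHr].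
  by rewrite big_nil /eis_val /= mul0r addr0.
by rewrite big_cons IHr /= valD valM valJ.
Qed.

Lemma multiunitary6 : exists M : 'M[C]_(6 * 6), multiunitary M.
Proof.
have [w [w2 wJ]] := cubic_root_of_unity C.
pose L (x y : 'I_6) : C := 6%:R^-1 * eis_val w (bell6 x y).
have sumL (u v : nat -> eisenstein) (a b : 'I_6) (u' v' : 'I_6 -> C) :
    eis_dot6 u v = ((if a == b :> nat then 36 else 0)%Z, 0) ->
    (forall i : 'I_6, u' i = 6%:R^-1 * eis_val w (u i)) ->
    (forall i : 'I_6, v' i = 6%:R^-1 * eis_val w (v i)) ->
  \sum_i u' i * (v' i)^* = (a == b)%:R.
  move=> dot_uv u'E v'E.
  transitivity (36%:R^-1 * \sum_(i < 6) eis_val w (u i) * (eis_val w (v i))^*).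
    rewrite mulr_sumr; apply: eq_bigr => i _.
    by rewrite u'E v'E rmorphM fmorphV rmorph_nat mulrACA -invfM -natrM.
  rewrite eis_dot6E // dot_uv /eis_val mul0r addr0 /= -val_eqE /=.
  by case: eqP; rewrite ?mulr0 // mulVf // pnatr_eq0.
apply: (@multiunitary_of_bell_diagonal 4 L) => s a b;
  have /and3P[/eqP row /eqP col /eqP twist] := for6P bell6_check s a b.
- exact: sumL row _ _.
- exact: sumL col _ _.
- exact: sumL twist _ _.
Qed.

Lemma multiunitary_exists N : (3 <= N)%N -> exists M : 'M[C]_(N * N), multiunitary M.
Proof.
move=> ge3; case: (eqVneq N 6) => [->|neq6]; first exact: multiunitary6.
exact/multiunitary_of_td/has_td4.
Qed.

Theorem mainTheorem15 :
  [/\ (exists psi : 'I_6 -> 'I_6 -> bivec 6, is_OQLS psi),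
      (exists Psi : quadvec 6, is_AME4 Psi),
      (exists M : 'M[C]_(6 * 6), multiunitary M) &
      (forall N : nat, (3 <= N)%N ->
         (exists psi : 'I_N -> 'I_N -> bivec N, is_OQLS psi) /\
         (exists Psi : quadvec N, is_AME4 Psi))].
Proof.
have all_N N : (3 <= N)%N -> (exists psi : 'I_N -> 'I_N -> bivec N, is_OQLS psi) /\
    (exists Psi : quadvec N, is_AME4 Psi).
  move=> ge3; have [M multiM] := multiunitary_exists ge3; split.
    by eexists; apply: OQLS_of_multiunitary multiM.
  by apply: AME4_of_multiunitary multiM; apply: leq_trans ge3.
by have [] := all_N 6 isT; split=> //; apply: multiunitary6.
Qed.
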